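(* Let $a,b,k$ be positive integers with $b>a$. Given any finite subset $F\subset C[0,1]_{(a,k)}$, any $\epsilon>0$, and any unital positive linear map $\phi:C[0,1]\to C[0,1]$ which sends $C[0,1]_{(a,k)}$ into $C[0,1]_{(b,k)}$, there are a positive integer $N$ and $N$ homomorphisms $\phi_1,\phi_2,\dots,\phi_N: C[0,1]\to C[0,1]$ such that $\frac1N\sum_{i=1}^N\phi_i(f)\in C[0,1]_{(b,k)}$ for all $f\in C[0,1]_{(a,k)}$, and $$\Big\|\phi(f)-\frac1N\sum_{i=1}^N\phi_i(f)\Big\|<\epsilon\quad\text{for all } f\in F.$$
   Context: $C[0,1]$ is the C*-algebra of continuous functions on $[0,1]$ with the supremum norm. For positive integers $a,k$, $$C[0,1]_{(a,k)}=\{f\in C[0,1]\mid f(0)=\tfrac{a}{a+k}f(1)\},$$ and $C[0,1]_{(b,k)}$ is defined in the same way with $b$ in place of $a$. Homomorphism means $*$-homomorphism. A linear map is positive if it sends nonnegative functions to nonnegative functions, and unital if it sends the constant function $1$ to $1$. *)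

(* Defs.v *)
From HB Require Import structures.
From mathcomp Require Import all_boot all_order all_algebra.
From mathcomp Require Import complex.
From mathcomp Require Import all_classical all_reals all_analysis.

Set Implicit Arguments.
Unset Strict Implicit.
Unset Printing Implicit Defensive.

Import Order.TTheory GRing.Theory Num.Theory.
Import numFieldNormedType.Exports.

Local Open Scope classical_set_scope.
Local Open Scope ring_scope.

Definition unit_interval (R : realType) : topologicalType :=
  set_type (`[0, 1]%classic : set R).

Section Endpoints.
Context {R : realType}.

Lemma mem_left : (0 : R) \in (`[0, 1]%classic : set R).
Proof. by rewrite inE /= in_itv /= lexx ler01. Qed.

Lemma mem_right : (1 : R) \in (`[0, 1]%classic : set R).
Proof. by rewrite inE /= in_itv /= lexx ler01. Qed.

Definition left_end : unit_interval R := exist _ 0 mem_left.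
Definition right_end : unit_interval R := exist _ 1 mem_right.

End Endpoints.

(* [R[i]^o] is [R[i]] with the topology of the complex modulus. *)
Definition C01 (R : realType) : Type :=
  continuousType (unit_interval R) (R[i]^o).

Section Algebra.
Context {R : realType}.
Local Notation I := (unit_interval R).
Local Notation C := (R[i]^o).

Definition continuous_pred : {pred I -> C} :=
  fun f => `[< continuous f >].

Lemma continuous_predP (f : I -> C) :
  reflect (continuous f) (f \in continuous_pred).
Proof. exact: asboolP. Qed.

Definition C01_val (f : C01 R) : I -> C := Continuous.sort f.

Definition C01_Sub (f : I -> C) (fP : f \in continuous_pred) : C01 R :=
  mkcts (elimT (continuous_predP f) fP).

Lemma C01_rect (K : C01 R -> Type) :
  (forall f (fP : f \in continuous_pred), K (C01_Sub fP)) -> forall u, K u.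
Proof.
move=> KSub u; have uP : C01_val u \in continuous_pred.
  by apply/continuous_predP; exact: (@cts_fun _ _ u).
suff -> : u = C01_Sub uP by exact: KSub.
exact/continuousEP.
Qed.

Lemma C01_valP f (fP : f \in continuous_pred) : C01_val (C01_Sub fP) = f.
Proof. by []. Qed.

HB.instance Definition _ :=
  @isSub.Build _ continuous_pred (C01 R) C01_val C01_Sub C01_rect C01_valP.
HB.instance Definition _ := [Choice of C01 R by <:].

Lemma continuous_subring_closed : subring_closed continuous_pred.
Proof.
split=> [|f g /continuous_predP cf /continuous_predP cg
         |f g /continuous_predP cf /continuous_predP cg];
  apply/continuous_predP => x.
- exact: (@cst_continuous I C 1 x).
- exact: (@continuousB R[i] C I f g x (cf x) (cg x)).
- exact: (@continuousM R[i] I f g x (cf x) (cg x)).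
Qed.

HB.instance Definition _ :=
  GRing.isSubringClosed.Build (I -> C) continuous_pred
    continuous_subring_closed.

Lemma continuous_scaler_closed : GRing.scaler_closed continuous_pred.
Proof.
move=> a f /continuous_predP cf; apply/continuous_predP => x.
exact: (@continuousZr R[i] C I f a x (cf x)).
Qed.

HB.instance Definition _ :=
  GRing.isScaleClosed.Build R[i] (I -> C) continuous_pred
    continuous_scaler_closed.

HB.instance Definition _ :=
  GRing.SubChoice_isSubComPzRing.Build (I -> C) continuous_pred (C01 R)
    continuous_subring_closed.
HB.instance Definition _ := [SubZmodule_isSubLmodule of C01 R by <:].

Lemma continuous_conjc : continuous (conjc : C -> C).
Proof.
move=> z; apply: (@cvgrPdist_lt _ C C (nbhs (z : C)) _ _ _).2 => e e0.
have zz : (fun w : C => w) @ z --> (z : C) by exact: cvg_id.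
apply: filterS ((@cvgrPdist_lt _ _ _ _ _ _ _).1 zz e e0) => w /=.
by rewrite -rmorphB normcJ.
Qed.

Lemma star_subproof (f : C01 R) :
  continuous ((conjc : C -> C) \o C01_val f).
Proof.
move=> x; apply: continuous_comp; first exact: (@cts_fun _ _ f).
exact: continuous_conjc.
Qed.

Definition star (f : C01 R) : C01 R := mkcts (@star_subproof f).

Definition supnorm (f : C01 R) : R :=
  sup (range (fun x : I => ComplexField.Normc.normc (f x))).

Definition C01_rel (a k : nat) : set (C01 R) :=
  [set f : C01 R | f left_end = a%:R / (a + k)%:R * f right_end].

(* In the order of [R[i]], [0 <= z] says that [z] is real and nonnegative. *)
Definition nonneg (f : C01 R) : Prop := forall x, 0 <= f x.

Definition positive_map (phi : C01 R -> C01 R) : Prop :=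
  forall f, nonneg f -> nonneg (phi f).

(* [psi 1 = 1] is not required: the zero map is a *-homomorphism. *)
Definition star_hom (psi : C01 R -> C01 R) : Prop :=
  [/\ linear psi, {morph psi : f g / f * g} & {morph psi : f / star f}].

End Algebra.

(* Main.v *)
Require Import Defs.
From HB Require Import structures.
From mathcomp Require Import all_boot all_order all_algebra.
From mathcomp Require Import complex.
From mathcomp Require Import all_classical all_reals all_analysis.
From mathcomp Require Import ring lra zify.
Import Order.TTheory GRing.Theory Num.Theory.
Import numFieldNormedType.Exports.
Local Open Scope classical_set_scope.
Local Open Scope ring_scope.

(** For each t, f |-> phi f t is integration against a probability measure
    mu_t on [0,1], so phi is a continuous path of measures.  Cutting mass 1
    into N slices of mass 1/N ordered from left to right and following the
    position of the i-th slice gives N paths h_i in [0,1] for which the mean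
    of the f \o h_i is near phi f.  The difficulty is that quantiles of mu_t
    need not be continuous in t; the proof never forms mu_t nor its quantiles.

    Fix a mesh 1/n on which the finitely many functions vary little, and let
    g_j be the piecewise affine function equal to 1 left of j/n and to 0 right
    of (j+1)/n.  Interpolation at the nodes writes f, up to a small error, as
    f(1) + \sum_j (f(j/n) - f((j+1)/n)) g_j, so up to a small error only the
    numbers L_j(t) = phi g_j t matter ([smooth_cdf_approx]): they are a
    distribution function for mu_t, smoothed so as to be continuous in t.
    Put h_i = (1/n) \sum_j clamp(i + 1 - N L_j), a continuous surrogate for
    the quantile of level i/N ([branch]).  For each j the clamps sum over i to
    exactly N - N L_j ([sum_clamp]), and at most one of them is fractional
    ([sum_fractional_le1]).  Hence, for fixed t, at all but n indices i the
    value h_i(t) is a node, where the interpolation formula is exact; the other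
    indices weigh at most n/N in the mean ([mean_branches_error]).

    The endpoint relation must hold exactly.  The hypothesis on phi says that
    phi f 0 - b/(b+k) phi f 1 is proportional to f(0) - a/(a+k) f(1);
    evaluated on g_j it becomes
    L_j(0) = (a+k)/(b+k) + b/(b+k) L_j(1) ([smooth_cdf_ends]).  If in addition
    all N L_j are integers at both endpoints, then no clamp is fractional
    there, the means at 0 and 1 are computed exactly by the L_j
    ([mean_branches_exact]), and the relation for the means follows.  So the
    L_j are first moved slightly to make the endpoint values integral while
    keeping them increasing in j and related as above ([adjusted_weights]).

    Everything is done for real parts; imaginary parts are the real parts of
    -i f. *)

Set Implicit Arguments.
Unset Strict Implicit.
Unset Printing Implicit Defensive.

Local Notation re := complex.Re.
Local Notation im := complex.Im.

(** * Averaging slices of a discrete distribution function *)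

Section Combinatorics.
Context {R : realFieldType}.
Implicit Types (x y w : R) (n N : nat) (u : R -> R).

Definition clamp x : R := Num.max 0 (Num.min 1 x).

Lemma clamp_ge0 x : 0 <= clamp x.
Proof. by rewrite /clamp le_max lexx. Qed.

Lemma clamp_le1 x : clamp x <= 1.
Proof. by rewrite /clamp ge_max ler01 ge_min lexx. Qed.

Lemma clamp_low x : x <= 0 -> clamp x = 0.
Proof.
move=> x0; apply/max_idPl; rewrite ge_min x0 orbT //.
Qed.

Lemma clamp_high x : 1 <= x -> clamp x = 1.
Proof. by move=> x1; rewrite /clamp (min_idPl x1); apply/max_idPr. Qed.

Lemma clamp_id x : 0 <= x <= 1 -> clamp x = x.
Proof.
by move=> /andP[x0 x1]; rewrite /clamp (min_idPr x1); apply/max_idPr.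
Qed.

Lemma le_clamp x y : x <= y -> clamp x <= clamp y.
Proof.
move=> xy; case: (lerP x 0) => x0; first by rewrite clamp_low // clamp_ge0.
case: (lerP 1 y) => y1; first by rewrite (clamp_high y1) clamp_le1.
by rewrite !clamp_id //; lra.
Qed.

Lemma clamp_cases x :
  [\/ x <= 0 /\ clamp x = 0, 1 <= x /\ clamp x = 1
    | 0 < x < 1 /\ clamp x = x].
Proof.
case: (lerP x 0) => x0; first by constructor 1; rewrite clamp_low.
case: (lerP 1 x) => x1; first by constructor 2; rewrite clamp_high.
by constructor 3; split; [lra|rewrite clamp_id //; lra].
Qed.

Lemma clamp1B x : 1 - clamp x = clamp (1 - x).
Proof.
have [[h ->]|[h ->]|[h ->]] := clamp_cases x.
- by rewrite clamp_high ?subr0 //; lra.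
- by rewrite clamp_low ?subrr //; lra.
- by rewrite clamp_id //; lra.
Qed.

(** clamp(x) is the increment of max(0, -) from x - 1 to x, so the sum
    telescopes. *)
Lemma sum_clamp_max N y : 0 <= y ->
  \sum_(i < N) clamp (i.+1%:R - y) = Num.max 0 (N%:R - y).
Proof.
move=> y0; elim: N => [|N IHN].
  by rewrite big_ord0; symmetry; apply/max_idPl; lra.
rewrite big_ord_recr /= IHN -natr1.
have [[h ->]|[h ->]|[h ->]] := clamp_cases (N%:R + 1 - y).
- by rewrite !(max_idPl _) ?addr0 //; lra.
- by rewrite !(max_idPr _) //; lra.
- by rewrite (max_idPl _) ?(max_idPr _) ?add0r //; lra.
Qed.

Lemma sum_clamp N y : 0 <= y <= N%:R ->
  \sum_(i < N) clamp (i.+1%:R - y) = N%:R - y.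
Proof.
by move=> /andP[y0 yN]; rewrite sum_clamp_max //; apply/max_idPr; lra.
Qed.

(** Two fractional terms would be two integers in an open interval of length
    1.  The induction uses that before the first i + 1 > y there is none. *)
Lemma sum_fractional_le1 N y :
  \sum_(i < N) ((0 < i.+1%:R - y < 1)%R : bool)%:R <= 1 :> R.
Proof.
suff H : \sum_(i < N) ((0 < i.+1%:R - y < 1)%R : bool)%:R
          <= ((y < N%:R)%R : bool)%:R :> R.
  by apply: le_trans H _; case: (y < _)%R; rewrite ?ler01.
elim: N => [|N IHN]; first by rewrite big_ord0 ler0n.
rewrite big_ord_recr /= -[N.+1%:R]natr1.
have [yN1|yN1] := ltrP y (N%:R + 1).
  have [yN|yN] := ltrP y N%:R.
    rewrite yN /= in IHN.
    have -> : (0 < N%:R + 1 - y < 1)%R = false by apply/negP; lra.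
    by rewrite addr0.
  apply: le_trans (lerD IHN (lexx _)) _.
  rewrite [(y < N%:R)%R]ltNge yN /= add0r.
  by rewrite ler_nat; case: (_ < _ < _)%R.
have -> : (0 < N%:R + 1 - y < 1)%R = false by apply/negP; lra.
rewrite addr0 (le_trans IHN) //.
by have -> : (y < N%:R)%R = false by apply/negP; lra.
Qed.

(** A decreasing 0/1 sequence is an initial segment of ones, so the two sums
    count it and telescope along it. *)
Lemma sum_step n (c u : nat -> R) :
  (forall j, (j < n)%N -> c j = 0 \/ c j = 1) ->
  (forall i j, (i <= j < n)%N -> c j <= c i) ->
  exists2 J, (J <= n)%N &
    \sum_(j < n) c j = J%:R /\ \sum_(j < n) c j * (u j.+1 - u j) = u J - u 0%N.
Proof.
elim: n => [|n IHn] c01 cdec.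
  by exists 0%N => //; rewrite !big_ord0 subrr.
have [J Jn [s1 s2]] := IHn (fun j jn => c01 j (leqW jn))
  (fun i j ij => cdec i j ltac:(by case/andP: ij => -> /leqW ->)).
have [cn|cn] := c01 _ (ltnSn n).
  exists J; first exact: leqW.
  by rewrite !big_ord_recr /= cn mul0r !addr0.
have c1 j : (j < n.+1)%N -> c j = 1.
  move=> jn; have H : 1 <= c j by rewrite -cn; apply: cdec; rewrite -ltnS jn /=.
  by case: (c01 j jn) => // cj; move: H; rewrite cj ler10.
exists n.+1 => //; split.
  rewrite (eq_bigr (fun=> 1)); first by rewrite sumr_const card_ord.
  by move=> j _; apply: c1.
rewrite (eq_bigr (fun j : 'I_n.+1 => u j.+1 - u j)); last first.
  by move=> j _; rewrite c1 ?mul1r.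
elim: (n.+1) => [|m IHm]; first by rewrite big_ord0 subrr.
by rewrite big_ord_recr /= IHm; ring.
Qed.

Definition modulus n w (u : R -> R) :=
  forall x y, 0 <= x <= 1 -> 0 <= y <= 1 -> `|x - y| <= n%:R^-1 ->
    `|u x - u y| <= w.

Definition node n (j : nat) : R := j%:R / n%:R.

Lemma node_itv n j : (j <= n)%N -> 0 <= node n j <= 1.
Proof.
rewrite /node; case: n => [|n]; first by rewrite invr0 mulr0 lexx ler01.
move=> jn; rewrite divr_ge0 ?ler0n //= ler_pdivrMr ?ltr0n // mul1r ler_nat.
exact: jn.
Qed.

Lemma node0 n : node n 0 = 0. Proof. by rewrite /node mul0r. Qed.

Lemma nodenn n : (0 < n)%N -> node n n = 1.
Proof. by move=> n0; rewrite /node divff // pnatr_eq0 -lt0n. Qed.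

Lemma node_step n w u j : modulus n w u -> (j < n)%N ->
  `|u (node n j.+1) - u (node n j)| <= w.
Proof.
move=> uw jn; apply: uw; rewrite ?node_itv // ?(ltnW jn) //.
by rewrite /node -mulrBl -natrB // subSnn mul1r ger0_norm // invr_ge0 ler0n.
Qed.

(** Truncating the interpolation at the k-th cell makes the estimate
    inductive: cells left of x contribute their full increment, cells right of
    x nothing, and only the cell of x is partial. *)
Lemma interpolation_prefix n w u x : modulus n w u -> 0 <= w ->
    (0 < n)%N -> 0 <= x <= 1 -> forall k, (k <= n)%N ->
  let S := \sum_(j < k)
    clamp (n%:R * x - j%:R) * (u (node n j.+1) - u (node n j)) in
  (k%:R <= n%:R * x -> S = u (node n k) - u 0) /\
  (n%:R * x <= k%:R -> `|u x - (u 0 + S)| <= 2 * w).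
Proof.
move=> uw w0 n0 x01; have n0' : 0 < n%:R :> R by rewrite ltr0n.
elim=> [_|k IHk kn] /=.
  rewrite big_ord0 node0 subrr; split=> // nx.
  have -> : x = 0.
    apply/eqP; rewrite eq_le; case/andP: x01 => -> _; rewrite andbT.
    by rewrite -(ler_pM2l n0') mulr0.
  by rewrite addr0 subrr normr0 mulr_ge0.
have [Hge Hle] := IHk (ltnW kn); rewrite big_ord_recr /=.
set D := _ - u (node n k); have Dw : `|D| <= w by apply: node_step.
set S := \sum_(j < k) _ in Hge Hle *; rewrite -natr1.
split=> [kx|xk].
  rewrite clamp_high; last by lra.
  by rewrite Hge; [rewrite /D; ring|lra].
have [xk'|kx] := lerP (n%:R * x) k%:R.
  by rewrite clamp_low ?mul0r ?addr0; [exact: Hle|lra].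
rewrite Hge ?(ltW kx) //.
have : `|u x - u (node n k)| <= w.
  apply: uw; rewrite ?node_itv // ?(ltnW kn) //.
  rewrite -(ler_pM2l n0') mulfV ?gt_eqF //.
  rewrite -{1}[n%:R](@ger0_norm R) ?(ltW n0') //.
  rewrite -normrM mulrBr /node mulrCA mulfV ?gt_eqF // mulr1.
  by rewrite ger0_norm ?subr_ge0 ?(ltW kx) //; lra.
have c0 := clamp_ge0 (n%:R * x - k%:R).
have c1 := clamp_le1 (n%:R * x - k%:R).
move: Dw; set c := clamp _ in c0 c1 *; move=> Dw ux.
have -> : u x - (u 0 + (u (node n k) - u 0 + c * D)) =
          (u x - u (node n k)) - c * D by ring.
apply: le_trans (ler_normB _ _) _; rewrite normrM (ger0_norm c0).
have : c * `|D| <= 1 * w by apply: ler_pM.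
by lra.
Qed.

Lemma interpolation_error n w u x : modulus n w u -> 0 <= w ->
    (0 < n)%N -> 0 <= x <= 1 ->
  `|u x - (u 0 + \sum_(j < n)
      clamp (n%:R * x - j%:R) * (u (node n j.+1) - u (node n j)))| <= 2 * w.
Proof.
move=> uw w0 n0 x01.
apply: (interpolation_prefix uw w0 n0 x01 (leqnn n)).2.
by case/andP: x01 => _ x1; rewrite ler_piMr ?ler0n.
Qed.

Lemma sum_le_const n (F : nat -> R) w :
  (forall j, (j < n)%N -> F j <= w) -> \sum_(j < n) F j <= n%:R * w.
Proof.
move=> Fw; apply: le_trans (ler_sum _ (fun (j : 'I_n) _ => Fw j (ltn_ord j))) _.
by rewrite sumr_const card_ord mulr_natl.
Qed.

Lemma weighted_steps_le n w e u (c : nat -> R) : modulus n w u ->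
  (forall j, (j < n)%N -> `|c j| <= e) ->
  `|\sum_(j < n) c j * (u (node n j.+1) - u (node n j))| <= n%:R * (e * w).
Proof.
move=> uw ce; apply: le_trans (ler_norm_sum _ _ _) _.
apply: (@sum_le_const _
  (fun j => `|c j * (u (node n j.+1) - u (node n j))|)) => j jn.
by rewrite normrM; apply: ler_pM => //; [exact: ce|exact: node_step].
Qed.

Lemma sum_node_steps n u : (0 < n)%N ->
  \sum_(j < n) (u (node n j.+1) - u (node n j)) = u 1 - u 0.
Proof.
move=> n0.
have H m : \sum_(j < m) (u (node n j.+1) - u (node n j)) =
           u (node n m) - u (node n 0).
  elim: m => [|m IHm]; first by rewrite big_ord0 subrr.
  by rewrite big_ord_recr /= IHm; ring.
by rewrite H nodenn // node0.
Qed.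

(** Passes between the decreasing weights 1 - c j attached to the left
    endpoint and the increasing weights c j attached to the right one. *)
Lemma sum_steps_by_parts n u (c : nat -> R) : (0 < n)%N ->
  u 0 + \sum_(j < n) (1 - c j) * (u (node n j.+1) - u (node n j)) =
  u 1 + \sum_(j < n) c j * (u (node n j) - u (node n j.+1)).
Proof.
move=> n0.
have -> : u 1 = u 0 + \sum_(j < n) (u (node n j.+1) - u (node n j)).
  by rewrite sum_node_steps // addrC subrK.
rewrite -addrA -big_split /=; congr (_ + _).
by apply: eq_bigr => j _; ring.
Qed.

Section Branches.
Variables (n N : nat) (L : nat -> R).
Hypotheses (n_gt0 : (0 < n)%N) (N_gt0 : (0 < N)%N).
Hypothesis L01 : forall j, (j < n)%N -> 0 <= L j <= 1.
Hypothesis Lmono : forall i j, (i <= j < n)%N -> L i <= L j.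

(** If no clamp is fractional this is J/n, with J the number of j such that
    L j <= i/N: a quantile of the distribution with distribution function L.
    The clamps make it continuous in L. *)
Definition branch (i : nat) : R :=
  n%:R^-1 * \sum_(j < n) clamp (i.+1%:R - N%:R * L j).

Definition fractional (i : nat) : R :=
  \sum_(j < n) ((0 < i.+1%:R - N%:R * L j < 1)%R : bool)%:R.

Lemma branch_itv i : 0 <= branch i <= 1.
Proof.
have n0' : 0 < n%:R :> R by rewrite ltr0n.
rewrite /branch mulr_ge0 ?invr_ge0 ?ler0n ?sumr_ge0 //=; last first.
  by move=> j _; exact: clamp_ge0.
rewrite -(ler_pM2l n0') mulrA mulfV ?gt_eqF // mul1r.
by apply: (@sum_le_const _ (fun j => clamp (i.+1%:R - N%:R * L j))) => j _;
  exact: clamp_le1.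
Qed.

Lemma branch_node (u : R -> R) i :
  (forall j, (j < n)%N -> ~~ (0 < i.+1%:R - N%:R * L j < 1)%R) ->
  u (branch i) = u 0 + \sum_(j < n)
    clamp (i.+1%:R - N%:R * L j) * (u (node n j.+1) - u (node n j)).
Proof.
move=> good; pose c j := clamp (i.+1%:R - N%:R * L j).
have c01 j : (j < n)%N -> c j = 0 \/ c j = 1.
  move=> jn; have /negP := good j jn; rewrite /c.
  by case: (clamp_cases (i.+1%:R - N%:R * L j)) => [[_ ->]|[_ ->]|[? _]];
    [left|right|].
have cdec k j : (k <= j < n)%N -> c j <= c k.
  move=> kj; apply: le_clamp; rewrite lerD2l lerN2 ler_pM2l ?ltr0n //.
  exact: Lmono.
have [J Jn [s1 s2]] := sum_step (fun j => u (node n j)) c01 cdec.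
by rewrite s2 /branch s1 mulrC node0 /node addrC subrK.
Qed.

(** At a node there is no error.  Otherwise a crude bound suffices, because
    few indices are fractional: both values differ from u 0 by at most n
    steps of size w, up to the interpolation error. *)
Lemma branch_error w u i : modulus n w u -> 0 <= w ->
  `|u (branch i) - (u 0 + \sum_(j < n)
      clamp (i.+1%:R - N%:R * L j) * (u (node n j.+1) - u (node n j)))|
    <= (2 * n%:R + 2) * w * fractional i.
Proof.
move=> uw w0; have n0' : 0 < n%:R :> R by rewrite ltr0n.
have f0 : 0 <= fractional i by apply: sumr_ge0 => j _; rewrite ler0n.
have [/existsP[j jbad]|/existsPn good] :=
    boolP [exists j : 'I_n, (0 < i.+1%:R - N%:R * L j < 1)%R].
  have f1 : 1 <= fractional i.
    rewrite /fractional (bigD1 j) //= jbad lerDl.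
    by apply: sumr_ge0 => k _; rewrite ler0n.
  apply: (@le_trans _ _ ((2 * n%:R + 2) * w)); last first.
    by rewrite ler_peMr // mulr_ge0 // addr_ge0 // mulr_ge0 // ltW.
  have e1 := interpolation_error uw w0 n_gt0 (branch_itv i).
  have Q1 (z : R) : `|clamp z| <= 1.
    by rewrite ger0_norm ?clamp_ge0 ?clamp_le1.
  have e2 := @weighted_steps_le n w 1 u
    (fun j => clamp (n%:R * branch i - j%:R))
    uw (fun _ _ => Q1 _).
  have e3 := @weighted_steps_le n w 1 u (fun j => clamp (i.+1%:R - N%:R * L j))
    uw (fun _ _ => Q1 _).
  move: e1 e2 e3; rewrite !mul1r !ler_norml /=.
  set S1 := \sum_(_ < n) _; set S2 := \sum_(_ < n) _; lra.
rewrite branch_node; last by move=> j jn; exact: (good (Ordinal jn)).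
by rewrite subrr normr0 mulr_ge0 // mulr_ge0 // addr_ge0 // mulr_ge0 // ltW.
Qed.

(** The exact identity behind the construction: averaging over i turns each
    clamp into 1 - L j. *)
Lemma mean_branches_clamp (u : R -> R) :
  N%:R^-1 * \sum_(i < N) (u 0 + \sum_(j < n)
      clamp (i.+1%:R - N%:R * L j) * (u (node n j.+1) - u (node n j)))
  = u 1 + \sum_(j < n) L j * (u (node n j) - u (node n j.+1)).
Proof.
have N0' : N%:R != 0 :> R by rewrite pnatr_eq0 -lt0n.
rewrite big_split /= sumr_const card_ord exchange_big /=.
under eq_bigr => j _.
  rewrite -mulr_suml sum_clamp; last first.
    have /andP[l0 l1] := L01 (ltn_ord j).
    by rewrite mulr_ge0 //= -[X in _ <= X]mulr1 ler_wpM2l.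
  over.
rewrite -sum_steps_by_parts // mulrDr -[u 0 *+ N]mulr_natl mulrA mulVf //.
rewrite mul1r mulr_sumr; congr (_ + _); apply: eq_bigr => j _.
by field.
Qed.

Lemma mean_branches_error w u : modulus n w u -> 0 <= w ->
  `|N%:R^-1 * \sum_(i < N) u (branch i)
     - (u 1 + \sum_(j < n) L j * (u (node n j) - u (node n j.+1)))|
  <= N%:R^-1 * (n%:R * ((2 * n%:R + 2) * w)).
Proof.
move=> uw w0; rewrite -mean_branches_clamp -mulrBr -sumrB normrM.
have N0' : 0 < N%:R^-1 :> R by rewrite invr_gt0 ltr0n.
rewrite (ger0_norm (ltW N0')) ler_pM2l //.
apply: le_trans (ler_norm_sum _ _ _) _.
apply: le_trans (ler_sum _ (fun (i : 'I_N) _ => branch_error i uw w0)) _.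
rewrite -mulr_sumr mulrC ler_wpM2r //.
  by rewrite mulr_ge0 // addr_ge0 // mulr_ge0 // ler0n.
rewrite /fractional exchange_big /=.
rewrite -[X in _ <= X]mulr1.
by apply: (@sum_le_const _ (fun j => \sum_(i < N)
    ((0 < i.+1%:R - N%:R * L j < 1)%R : bool)%:R)) => j _;
  exact: sum_fractional_le1.
Qed.

(** With N L j integral no clamp is fractional, so every branch is a node,
    and u may be any function. *)
Lemma mean_branches_exact (u : R -> R) :
  (forall j, (j < n)%N -> exists q : nat, N%:R * L j = q%:R) ->
  N%:R^-1 * \sum_(i < N) u (branch i)
   = u 1 + \sum_(j < n) L j * (u (node n j) - u (node n j.+1)).
Proof.
move=> Lnat; rewrite -mean_branches_clamp; congr (_ * _).
apply: eq_bigr => i _; apply: branch_node => j jn.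
have [q ->] := Lnat j jn.
apply/negP; rewrite subr_gt0 ltrBlDr addrC -natr1 ltrD2r.
by rewrite !natr1 !ltr_nat ltnS => /andP[? ?]; lia.
Qed.

End Branches.
End Combinatorics.

(** * Complex parts and the topology of the unit interval *)

Section ComplexParts.
Context {R : realType}.
Implicit Types z : R[i].

Lemma ReD z z' : re (z + z') = re z + re z'.
Proof. by case: z z' => [? ?] [? ?]. Qed.
Lemma ReN z : re (- z) = - re z.
Proof. by case: z. Qed.
Lemma ReB z z' : re (z - z') = re z - re z'.
Proof. by rewrite ReD ReN. Qed.
Lemma ReZ (r : R) z : re (r%:C%C * z) = r * re z.
Proof. by case: z => [x y] /=; rewrite mul0r subr0. Qed.
Lemma Re_sum (I : Type) (r : seq I) (F : I -> R[i]) :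
  re (\sum_(i <- r) F i) = \sum_(i <- r) re (F i).
Proof. exact: (big_morph _ ReD). Qed.
Lemma Re_mulNi z : re (- 'i%C * z) = im z.
Proof. by case: z => [x y] /=; ring. Qed.

Lemma natC (n : nat) : n%:R = (n%:R : R)%:C%C.
Proof. by rewrite rmorph_nat. Qed.

Lemma normc_le_ReIm z : ComplexField.Normc.normc z <= `|re z| + `|im z|.
Proof.
case: z => [x y] /=.
rewrite -[leRHS]ger0_norm ?addr_ge0 // -sqrtr_sqr ler_wsqrtr //.
rewrite sqrrD !real_normK ?num_real // -addrA lerD2l lerDr.
by rewrite mulrn_wge0 // mulr_ge0.
Qed.

Lemma Re_continuous : continuous (@complex.Re R : R[i]^o -> R).
Proof.
move=> z; apply: (@cvgrPdist_lt _ R (R[i]^o) (nbhs (z : R[i]^o)) _ _ _).2.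
move=> e e0.
have zz : (fun w : R[i]^o => w) @ z --> (z : R[i]^o) by exact: cvg_id.
have e0' : 0 < e%:C%C :> R[i] by rewrite ltcR.
apply: filterS ((@cvgrPdist_lt _ _ _ _ _ _ _).1 zz _ e0') => w /= zw.
rewrite -ReB -ltcR; exact: le_lt_trans (normc_ge_Re _) zw.
Qed.

Lemma real_complex_continuous : continuous (fun x : R => x%:C%C : R[i]^o).
Proof.
move=> x; apply: (@cvgrPdist_lt _ (R[i]^o) R (nbhs (x : R)) _ _ _).2 => e e0.
have er : 0 < re e by move: e0; rewrite ltcE => /andP[].
have zz : (fun w : R => w) @ x --> x by exact: cvg_id.
apply: filterS ((@cvgrPdist_lt _ _ _ _ _ _ _).1 zz _ er) => w /= xw.
rewrite -rmorphB /= normc_def /= expr0n /= addr0 sqrtr_sqr ltcE /= xw andbT.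
by move: e0; rewrite ltcE => /andP[].
Qed.

End ComplexParts.

Section Interval.
Context {R : realType}.
Local Notation I := (unit_interval R).

Lemma clamp_mem (x : R) : clamp x \in (`[0, 1]%classic : set R).
Proof. by rewrite inE /= in_itv /= clamp_ge0 clamp_le1. Qed.

(** The retraction of the line onto the interval.  Through it, functions on
    [0,1] become functions on R, and paths can be built with real
    arithmetic. *)
Definition to_interval (x : R) : I := exist _ (clamp x) (clamp_mem x).

Definition abscissa (t : I) : R := sval t.

Lemma abscissa_itv (t : I) : 0 <= abscissa t <= 1.
Proof. by have := svalP t; rewrite inE /= in_itv. Qed.

Lemma abscissa_inj : injective abscissa.
Proof. by move=> s t; exact: val_inj. Qed.

Lemma abscissa_to_interval x : 0 <= x <= 1 -> abscissa (to_interval x) = x.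
Proof. exact: clamp_id. Qed.

Lemma to_interval_abscissa t : to_interval (abscissa t) = t.
Proof.
by apply: abscissa_inj; rewrite abscissa_to_interval // abscissa_itv.
Qed.

Lemma left_endE : left_end = to_interval 0.
Proof. by apply: abscissa_inj; rewrite abscissa_to_interval // lexx ler01. Qed.

Lemma right_endE : right_end = to_interval 1.
Proof. by apply: abscissa_inj; rewrite abscissa_to_interval // lexx ler01. Qed.

Lemma clamp_continuous : continuous (@clamp R).
Proof.
move=> x.
have c1 : {for x, continuous ((fun=> 1) \min idfun : R -> R^o)}.
  by apply: continuous_min; [exact: cst_continuous|exact: cvg_id].
have c0 : {for x, continuous ((fun=> 0) : R -> R^o)} by exact: cst_continuous.
exact: (continuous_max c0 c1).
Qed.

Lemma abscissa_continuous : continuous abscissa.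
Proof. exact: initial_continuous. Qed.

Lemma to_interval_continuous : continuous to_interval.
Proof.
move=> x U [_ [[W oW <-] Wx WU]].
have nW : nbhs (clamp x : R) W by apply: open_nbhs_nbhs; split.
have cW : nbhs x (fun y : R => W (clamp y)).
  exact: (@clamp_continuous x W nW).
move: cW; apply: filterS => y Wy.
exact: WU.
Qed.

(** Heine-Cantor on [0,1], by the near-covering form of compactness. *)
Lemma uniform_modulus (u : R -> R) w : continuous u -> 0 < w ->
  exists n0, forall n, (n0 <= n)%N -> modulus n w u.
Proof.
move=> cu w0.
have /compact_near_coveringP H := @segment_compact R 0 1.
have [] := H nat \oo (fun n x => forall y, `|x - y| <= n%:R^-1 ->
   `|u x - u y| <= w) _; last first.
  move=> n0 _ Hn; exists n0 => n nn x y x01 _ xy; exact: (Hn n nn x).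
move=> x _.
have [d /= d0 xd] : nbhs_ball x (fun y => `|u x - u y| < w / 2).
  apply/nbhs_ballP/((@cvgrPdist_lt _ _ _ _ _ _ _).1 (cu x)).
  by rewrite divr_gt0.
have d2 : 0 < d / 2 by rewrite divr_gt0.
exists (ball x (d/2), [set n | n%:R^-1 < d / 2]).
  split; first exact: nbhsx_ballx.
  have [m _ Hm] := near_infty_natSinv_lt (PosNum d2).
  exists m.+1 => // -[//|n] /= mn; exact: (Hm n).
move=> [x' n] [/= xx' nd] y x'y; move: xx'; rewrite /ball /= => xx'.
have h1 : `|u x - u x'| < w / 2 by apply: xd; rewrite /ball /=; lra.
have h2 : `|u x - u y| < w / 2.
  apply: xd; rewrite /ball /= -(subrKA x').
  by apply: le_lt_trans (ler_normD _ _) _; lra.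
rewrite -(subrKA (u x)); apply: le_trans (ler_normD _ _) _.
by rewrite distrC; lra.
Qed.

End Interval.

(** * The algebra C[0,1] and its positive unital maps *)

Section Evaluation.
Context {R : realType}.
Local Notation I := (unit_interval R).
Implicit Types (f g : C01 R) (t : I).

Lemma C01D f g t : (f + g) t = f t + g t. Proof. by []. Qed.
Lemma C01N f t : (- f) t = - f t. Proof. by []. Qed.
Lemma C01B f g t : (f - g) t = f t - g t. Proof. by []. Qed.
Lemma C01M f g t : (f * g) t = f t * g t. Proof. by []. Qed.
Lemma C01Z (z : R[i]) f t : (z *: f) t = z * f t. Proof. by []. Qed.
Lemma C011 t : (1 : C01 R) t = 1. Proof. by []. Qed.
Lemma C01_sum (J : Type) (r : seq J) (F : J -> C01 R) t :
  (\sum_(j <- r) F j) t = \sum_(j <- r) F j t.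
Proof. exact: (big_morph (fun f : C01 R => f t) (fun f g => C01D f g t)). Qed.
Lemma C01_ext f g : (forall t, f t = g t) -> f = g.
Proof. by move=> fg; exact/continuousEP. Qed.

Definition of_real (u : I -> R) (cu : continuous u) : C01 R :=
  mkcts (fun t => @continuous_comp _ _ _ u (fun x : R => x%:C%C : R[i]^o) t
    (cu t) (@real_complex_continuous R (u t))).

Lemma of_realE u (cu : continuous u) t : of_real cu t = (u t)%:C%C.
Proof. by []. Qed.

Definition pullback (h : I -> R) (ch : continuous h) (f : C01 R) : C01 R :=
  mkcts (fun t => @continuous_comp _ _ _ (to_interval \o h) (f : I -> R[i]^o) t
    (@continuous_comp _ _ _ h to_interval t (ch t)
      (@to_interval_continuous R (h t)))
    (@cts_fun _ _ f (to_interval (h t)))).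

Lemma star_hom_pullback h (ch : continuous h) : star_hom (pullback ch).
Proof. by split=> [z f g|f g|f]; apply: C01_ext. Qed.

Definition profile f (x : R) : R := re (f (to_interval x)).

Lemma profile_continuous f : continuous (profile f).
Proof.
move=> x; apply: (@continuous_comp _ _ _ to_interval (fun t => re (f t))).
  exact: to_interval_continuous.
apply: (@continuous_comp _ _ _ (f : I -> R[i]^o) (@complex.Re R : R[i]^o -> R)).
  exact: (@cts_fun _ _ f).
exact: Re_continuous.
Qed.

Lemma real_part_continuous f : continuous (fun t : I => re (f t)).
Proof.
move=> t.
apply: (@continuous_comp _ _ _ (f : I -> R[i]^o) (@complex.Re R : R[i]^o -> R)).
  exact: (@cts_fun _ _ f).
exact: Re_continuous.
Qed.

End Evaluation.

Section PositiveMaps.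
Context {R : realType}.
Local Notation I := (unit_interval R).
Implicit Types (f g : C01 R) (t : I).
Variable phi : {linear C01 R -> C01 R}.
Hypotheses (phi1 : phi 1 = 1) (phi_pos : positive_map phi).

(** A real function is a difference of squares,
    4 f = (f + 1)^2 - (f - 1)^2, hence of nonnegative functions; this form
    avoids proving f bounded. *)
Lemma positive_real f : (forall t, im (f t) = 0) -> forall t, im (phi f t) = 0.
Proof.
move=> fr t.
have sq g : (forall s, im (g s) = 0) -> nonneg (g * g).
  move=> gr s; rewrite C01M; move: (gr s); case: (g s) => x y /= ->.
  by rewrite -[_ * _]/(x%:C%C * x%:C%C) -rmorphM ler0c -expr2 sqr_ge0.
have fE : f = (4%:R^-1 : R[i]) *: ((f + 1) * (f + 1) - (f - 1) * (f - 1)).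
  apply: C01_ext => s; rewrite C01Z C01B !C01M C01D C01B C011.
  by field.
rewrite fE linearZ linearB /= C01Z C01B.
have p1 : 0 <= phi ((f + 1) * (f + 1)) t.
  apply: phi_pos; apply: sq => s; rewrite C01D C011; move: (fr s).
  by case: (f s) => x y /= ->; rewrite addr0.
have p2 : 0 <= phi ((f - 1) * (f - 1)) t.
  apply: phi_pos; apply: sq => s; rewrite C01B C011; move: (fr s).
  by case: (f s) => x y /= ->; rewrite subr0.
have -> : (4%:R^-1 : R[i]) = (4%:R^-1 : R)%:C%C by rewrite fmorphV rmorph_nat.
move: p1 p2; rewrite !lecE => /andP[/eqP + _] /andP[/eqP + _].
by case: (phi _ t) => a b; case: (phi _ t) => c d /= -> ->; ring.
Qed.

(** A positive map commutes with taking real parts: f - Re f is i times a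
    real function, whose image is again i times a real function.  The bound
    then comes from e - Re f >= 0. *)
Lemma positive_Re_le f e : (forall t, re (f t) <= e) ->
  forall t, re (phi f t) <= e.
Proof.
move=> fe t; pose g : C01 R := of_real (@real_part_continuous R f).
have h1 : im (phi ((- 'i%C) *: (f - g)) t) = 0.
  apply: positive_real => s; rewrite C01Z C01B /g of_realE.
  by case: (f s) => x y /=; ring.
have -> : re (phi f t) = re (phi g t).
  move: h1; rewrite linearZ linearB /= C01Z C01B.
  by case: (phi f t) => a b; case: (phi g t) => c d /= h; lra.
have : nonneg (e%:C%C *: (1 : C01 R) - g).
  by move=> s; rewrite C01B C01Z C011 mulr1 of_realE -rmorphB ler0c subr_ge0 fe.
move/phi_pos => /(_ t); rewrite linearB linearZ /= phi1 C01B C01Z C011.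
rewrite lecE => /andP[_].
by case: (phi g t) => c d /=; lra.
Qed.

Lemma positive_Re_norm_le f e : (forall t, `|re (f t)| <= e) ->
  forall t, `|re (phi f t)| <= e.
Proof.
move=> fe t; rewrite ler_norml; apply/andP; split; last first.
  by apply: positive_Re_le => s; have := fe s; rewrite ler_norml => /andP[].
rewrite lerNl -ReN -C01N -linearN; apply: positive_Re_le => s.
by rewrite C01N ReN lerNl; have := fe s; rewrite ler_norml => /andP[].
Qed.

End PositiveMaps.

(** * The smoothed distribution function of a positive map *)

(** Rounding y j up to a multiple of 1/M and adding j/M: the extra j/M
    compensates for the oscillation of the rounding error and makes the
    corrections w increase with j, whether or not y does. *)
Lemma monotone_rounding (R : realType) (M n : nat) (y : nat -> R) :
  (0 < M)%N -> (forall j, 0 <= y j) ->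
  exists w : nat -> R,
    [/\ forall j, (j < n)%N -> 0 <= w j <= n%:R / M%:R,
        forall i j, (i <= j)%N -> w i <= w j &
        forall j, exists q : nat, M%:R * (y j + w j) = q%:R].
Proof.
move=> M0 y0; have M0' : 0 < M%:R :> R by rewrite ltr0n.
have tr j := truncn_itv (mulr_ge0 (ltW M0') (y0 j)).
exists (fun j => (Num.truncn (M%:R * y j) + j.+1)%:R / M%:R - y j); split.
- move=> j jn; have /andP[t1 t2] := tr j.
  have jn' : j.+1%:R <= n%:R :> R by rewrite ler_nat.
  rewrite subr_ge0 ler_pdivlMr // lerBlDr ler_pdivrMr // mulrDl.
  rewrite divfK ?gt_eqF //.
  move: t1 t2 jn'; rewrite natrD [_ * y j]mulrC -!natr1.
  have := ler0n R j; lra.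
- move=> i j; rewrite leq_eqVlt => /orP[/eqP -> //|ij].
  have /andP[t1 t2] := tr i; have /andP[t3 t4] := tr j.
  have ij' : i.+1%:R <= j%:R :> R by rewrite ler_nat.
  rewrite -(ler_pM2l M0') !mulrBr !mulrA ![M%:R * _ / _]mulrC.
  rewrite !mulrA !mulVf ?gt_eqF // !mul1r !natrD.
  move: t1 t2 t3 t4 ij'; rewrite -!natr1; lra.
- move=> j; exists (Num.truncn (M%:R * y j) + j.+1)%N.
  by rewrite addrC subrK mulrC divfK ?gt_eqF.
Qed.

Section Weights.
Context {R : realType}.
Local Notation I := (unit_interval R).
Implicit Types (f g : C01 R) (t : I).
Variable phi : {linear C01 R -> C01 R}.
Hypotheses (phi1 : phi 1 = 1) (phi_pos : positive_map phi).
Variable n : nat.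
Hypothesis n_gt0 : (0 < n)%N.

Lemma plateau_continuous j :
  continuous (fun t : I => clamp (j.+1%:R - n%:R * abscissa t) : R).
Proof.
move=> t; apply: (@continuous_comp _ _ _
  (fun t : I => j.+1%:R - n%:R * abscissa t) (@clamp R)); last first.
  exact: clamp_continuous.
apply: (@continuousB R R^o I (fun=> j.+1%:R) (fun t => n%:R * abscissa t)).
  exact: cst_continuous.
apply: (@continuousM R I (fun=> n%:R) abscissa); first exact: cst_continuous.
exact: abscissa_continuous.
Qed.

(** Equal to 1 up to j/n, to 0 from (j+1)/n on, and affine in between. *)
Definition plateau j : C01 R := of_real (@plateau_continuous j).

(** Up to the smoothing, the mass that the measure at t gives to [0, j/n]. *)
Definition smooth_cdf j t : R := re (phi (plateau j) t).

Lemma phi_plateau j t : phi (plateau j) t = (smooth_cdf j t)%:C%C.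
Proof.
have := @positive_real R phi phi_pos (plateau j) (fun=> erefl) t.
by rewrite /smooth_cdf; case: (phi (plateau j) t) => x y /= ->.
Qed.

Lemma smooth_cdf_continuous j : continuous (smooth_cdf j).
Proof. exact: real_part_continuous. Qed.

Lemma smooth_cdf_itv j t : 0 <= smooth_cdf j t <= 1.
Proof.
apply/andP; split; last first.
  by apply: positive_Re_le => // s; rewrite of_realE /= clamp_le1.
have : nonneg (plateau j) by move=> s; rewrite of_realE ler0c clamp_ge0.
by move/phi_pos/(_ t); rewrite phi_plateau ler0c.
Qed.

Lemma smooth_cdf_mono i j t : (i <= j)%N -> smooth_cdf i t <= smooth_cdf j t.
Proof.
move=> ij; have : nonneg (plateau j - plateau i).
  move=> s; rewrite C01B !of_realE -rmorphB ler0c subr_ge0 le_clamp //.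
  by rewrite lerD2r ler_nat.
move/phi_pos/(_ t); rewrite linearB /= C01B !phi_plateau -rmorphB ler0c.
by rewrite subr_ge0.
Qed.

(** phi is applied to the piecewise affine interpolation of f, written in the
    plateaus; its real part is moved by at most the interpolation error. *)
Lemma smooth_cdf_approx f w t : modulus n w (profile f) -> 0 <= w ->
  `|re (phi f t) - (profile f 1 + \sum_(j < n) smooth_cdf j t *
      (profile f (node n j) - profile f (node n j.+1)))| <= 2 * w.
Proof.
move=> fw w0.
pose D (j : nat) : R[i] :=
  f (to_interval (node n j)) - f (to_interval (node n j.+1)).
pose g : C01 R :=
  f (to_interval 1) *: (1 : C01 R) + \sum_(j < n) D j *: plateau j.
have gE s : re (g s) = profile f 1 + \sum_(j < n)
    clamp (j.+1%:R - n%:R * abscissa s) *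
      (profile f (node n j) - profile f (node n j.+1)).
  rewrite C01D C01Z C011 mulr1 ReD C01_sum Re_sum; congr (_ + _).
  by apply: eq_bigr => j _; rewrite C01Z of_realE mulrC ReZ ReB.
have pgE : re (phi g t) = profile f 1 + \sum_(j < n) smooth_cdf j t *
      (profile f (node n j) - profile f (node n j.+1)).
  rewrite linearD linearZ linear_sum /= phi1 C01D C01Z C011 mulr1 ReD C01_sum.
  rewrite Re_sum; congr (_ + _); apply: eq_bigr => j _.
  by rewrite linearZ /= C01Z phi_plateau mulrC ReZ ReB.
rewrite -pgE -ReB -C01B -linearB; apply: positive_Re_norm_le => // s.
rewrite C01B ReB gE -(sum_steps_by_parts (profile f)
  (fun j => clamp (j.+1%:R - n%:R * abscissa s))) //.
have -> : re (f s) = profile f (abscissa s).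
  by rewrite /profile to_interval_abscissa.
under eq_bigr => j _.
  rewrite clamp1B (_ : 1 - _ = n%:R * abscissa s - j%:R); last first.
    by rewrite -natr1; ring.
  over.
by apply: interpolation_error => //; exact: abscissa_itv.
Qed.

Variables (a b k : nat).
Hypotheses (k_gt0 : (0 < k)%N) (ltab : (a < b)%N).
Hypothesis phi_rel : forall f, C01_rel a k f -> C01_rel b k (phi f).

(** The plateau takes the values 1 and 0 at the endpoints; subtracting the
    constant (a+k)/k puts it in the domain of the relation. *)
Lemma smooth_cdf_ends j : (j < n)%N ->
  smooth_cdf j left_end = (a + k)%:R / (b + k)%:R
                      + b%:R / (b + k)%:R * smooth_cdf j right_end.
Proof.
move=> jn.
have k0 : k%:R != 0 :> R by rewrite pnatr_eq0 -lt0n.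
have pk0 p : p%:R + k%:R != 0 :> R.
  by rewrite -natrD pnatr_eq0 addn_eq0 negb_and -!lt0n k_gt0 orbT.
pose s : R := (a + k)%:R / k%:R.
pose q : C01 R := plateau j - s%:C%C *: (1 : C01 R).
have qE t : q t = (clamp (j.+1%:R - n%:R * abscissa t) - s)%:C%C.
  by rewrite /q C01B C01Z C011 mulr1 of_realE -rmorphB.
have phiqE t : phi q t = (smooth_cdf j t - s)%:C%C.
  rewrite /q linearB linearZ /= phi1 C01B C01Z C011 mulr1.
  by rewrite phi_plateau -rmorphB.
have : C01_rel a k q.
  rewrite /C01_rel /mkset !qE left_endE right_endE.
  rewrite !abscissa_to_interval ?lexx ?ler01 // mulr0 subr0 mulr1.
  rewrite clamp_high ?ler1n // clamp_low ?subr_le0 ?ler_nat //.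
  rewrite !natC -fmorphV -!rmorphM /=; congr (_%:C%C).
  by rewrite /s !natrD; field; rewrite k0 pk0.
move/phi_rel; rewrite /C01_rel /mkset !phiqE !natC -fmorphV -!rmorphM /=.
move/complexI/(canRL (subrK _)) => ->.
by rewrite /s !natrD; field; rewrite k0 pk0.
Qed.

(** A convex mixture: L keeps the weight 1 - n/m, and the remaining n/m is
    spent on corrections, affine in t, that make the values at both endpoints
    multiples of 1/N.  Since the corrections w increase with j,
    monotonicity survives.  Rounding is done at the right end only, to
    multiples of 1/(b m); the relation between the ends then makes the left
    values multiples of 1/(b m (b + k)). *)
Lemma adjusted_weights m : (n <= m)%N ->
  exists V : nat -> I -> R,
  [/\ forall j, continuous (V j),
      forall j t, (j < n)%N -> 0 <= V j t <= 1,
      forall i j t, (i <= j < n)%N -> V i t <= V j t,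
      forall j t, (j < n)%N -> `|V j t - smooth_cdf j t| <= n%:R / m%:R &
      forall j, (j < n)%N ->
        [/\ V j left_end = (a + k)%:R / (b + k)%:R
                            + b%:R / (b + k)%:R * V j right_end,
           exists q : nat, (b * m * (b + k))%:R * V j left_end = q%:R &
           exists q : nat, (b * m * (b + k))%:R * V j right_end = q%:R]].
Proof.
move=> nm; have m0 : (0 < m)%N by exact: leq_trans nm.
have b0 : (0 < b)%N by exact: leq_ltn_trans ltab.
have M0 : (0 < b * m)%N by rewrite muln_gt0 b0.
pose e : R := n%:R / m%:R; pose d : R := n%:R / (b * m)%:R.
have ed : e = b%:R * d.
  by rewrite /e /d natrM; field; rewrite !pnatr_eq0 -!lt0n m0.
have d0 : 0 <= d by rewrite divr_ge0.
pose al : R := (a + k)%:R / (b + k)%:R; pose be : R := b%:R / (b + k)%:R.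
have bk0 : 0 < (b + k)%:R :> R by rewrite ltr0n addn_gt0 b0.
have be0 : 0 <= be by rewrite divr_ge0.
have al0 : 0 <= al by rewrite divr_ge0.
(* This is where a < b enters: it leaves room for the left correction. *)
have albe : b%:R * al + be <= b%:R.
  rewrite /al /be mulrA -mulrDl ler_pdivrMr //.
  by rewrite -natrM -natrD -natrM ler_nat; nia.
have b1 : 1 <= b%:R :> R by rewrite ler1n.
have e0 : 0 <= e by rewrite divr_ge0.
have e1 : 0 <= 1 - e.
  by rewrite subr_ge0 ler_pdivrMr ?ltr0n // mul1r ler_nat.
pose y j := (1 - e) * smooth_cdf j right_end.
have y0 j : 0 <= y j.
  have /andP[w0 _] := smooth_cdf_itv j right_end.
  by rewrite mulr_ge0.
have [w [w_itv w_mono w_nat]] := monotone_rounding n M0 y0.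
pose V j t : R := (1 - e) * smooth_cdf j t
  + (1 - abscissa t) * (e * al + be * w j) + abscissa t * w j.
have Vw j t : (j < n)%N -> 0 <= V j t - (1 - e) * smooth_cdf j t <= e.
  move=> jn; have /andP[wj0 wj1] := w_itv j jn; rewrite -/d in wj1.
  have /andP[x0 x1] := abscissa_itv t.
  have W0 : 0 <= e * al + be * w j by rewrite addr_ge0 // mulr_ge0.
  have W1 : e * al + be * w j <= e.
    have : be * w j <= be * d by rewrite ler_wpM2l.
    have : d * (b%:R * al + be) <= d * b%:R by rewrite ler_wpM2l.
    by rewrite ed; nra.
  have w1 : w j <= e by rewrite ed; nra.
  by rewrite /V; apply/andP; split; nra.
exists V; split.
- move=> j t; rewrite /V.
  have cst (r : R) : {for t, continuous (fun _ : I => r)}.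
    exact: cst_continuous.
  have cw := @smooth_cdf_continuous j t; have cx := @abscissa_continuous R t.
  have c1 := @continuousM R I _ _ t (cst (1 - e)) cw.
  have c2 := @continuousM R I _ _ t (@continuousB R R^o I _ _ t (cst 1) cx)
    (cst (e * al + be * w j)).
  have c3 := @continuousM R I _ _ t cx (cst (w j)).
  exact: (@continuousD R R^o I _ _ t (@continuousD R R^o I _ _ t c1 c2) c3).
- move=> j t jn; have := Vw j t jn; have := smooth_cdf_itv j t; nra.
- move=> i j t /andP[ij jn]; have wij := w_mono i j ij.
  have lij := smooth_cdf_mono t ij; have /andP[x0 x1] := abscissa_itv t.
  rewrite /V; apply: lerD; [apply: lerD|]; first exact: ler_wpM2l.
    by rewrite ler_wpM2l ?subr_ge0 // lerD2l ler_wpM2l.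
  exact: ler_wpM2l.
- move=> j t jn; have := Vw j t jn; have := smooth_cdf_itv j t; rewrite -/e.
  by rewrite ler_norml; nra.
- move=> j jn.
  have Vr : V j right_end = y j + w j.
    rewrite /V /y right_endE abscissa_to_interval ?lexx ?ler01 //.
    by rewrite subrr mul0r addr0 mul1r.
  have Vl : V j left_end = al + be * V j right_end.
    rewrite Vr /V /y left_endE abscissa_to_interval ?lexx ?ler01 // -left_endE.
    rewrite smooth_cdf_ends // -/al -/be; ring.
  have [q qE] := w_nat j; rewrite -Vr in qE.
  split=> //; last first.
    by exists (q * (b + k))%N; rewrite !natrM -qE natrM; ring.
  exists (b * m * (a + k) + b * q)%N; rewrite Vl natrD.
  rewrite [(b * q)%:R]natrM -qE /al /be ![(_ * (_ + k))%:R]natrM.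
  by field; rewrite -natrD gt_eqF.
Qed.

(** Three errors: interpolation (2 w), replacing L by V (at most n steps of
    size w times n/m), and the fractional slices. *)
Lemma approximation_by_branches f w m (V : nat -> I -> R) N t :
    modulus n w (profile f) -> 0 <= w -> (0 < m)%N -> (0 < N)%N ->
    (n * n <= m)%N -> (n * (2 * n + 2) <= N)%N ->
    (forall j, (j < n)%N -> 0 <= V j t <= 1) ->
    (forall i j, (i <= j < n)%N -> V i t <= V j t) ->
    (forall j, (j < n)%N -> `|V j t - smooth_cdf j t| <= n%:R / m%:R) ->
  `|re (phi f t) - N%:R^-1 * \sum_(i < N)
      profile f (branch n N (V ^~ t) i)| <= 4 * w.
Proof.
move=> fw w0 m0 N0 nm nN V01 Vmono Vw.
have h1 := smooth_cdf_approx t fw w0.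
have h2 := mean_branches_error n_gt0 N0 V01 Vmono fw w0.
have h3 := weighted_steps_le fw Vw.
have h4 : n%:R * (n%:R / m%:R * w) <= w.
  rewrite mulrA ler_piMl // mulrA ler_pdivrMr ?ltr0n // mul1r -natrM.
  by rewrite ler_nat.
have h5 : N%:R^-1 * (n%:R * ((2 * n%:R + 2) * w)) <= w.
  rewrite ler_pdivrMl ?ltr0n // mulrA ler_wpM2r //.
  by rewrite -!(natrM, natrD) ler_nat.
have h6 : \sum_(j < n) (V j t - smooth_cdf j t) *
    (profile f (node n j.+1) - profile f (node n j)) =
  (\sum_(j < n) smooth_cdf j t *
      (profile f (node n j) - profile f (node n j.+1))) -
  (\sum_(j < n) V j t *
      (profile f (node n j) - profile f (node n j.+1))).
  by rewrite -sumrB; apply: eq_bigr => j _; ring.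
move: h3; rewrite h6; move: h1 h2; rewrite !ler_norml.
set S1 := \sum_(_ < n) _; set S2 := \sum_(_ < n) _; set S3 := \sum_(_ < N) _.
lra.
Qed.

End Weights.

(** * Assembling the homomorphisms *)

Section Main.
Context {R : realType}.
Local Notation I := (unit_interval R).
Implicit Types (f g : C01 R) (t : I).

Lemma supnorm_le f w : (forall t, `|re (f t)| <= w) ->
  (forall t, `|im (f t)| <= w) -> supnorm f <= w + w.
Proof.
move=> fr fi; apply: ge_sup; first by apply: image_nonempty; exists left_end.
move=> _ [t _ <-]; apply: le_trans (normc_le_ReIm _) _.
exact: lerD.
Qed.

Lemma common_modulus (F : set (C01 R)) w : finite_set F -> 0 < w ->
  exists2 n, (0 < n)%N & forall f, F f -> modulus n w (profile f).
Proof.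
move=> /finite_seqP[s ->] w0.
suff [n0 Hn] : exists n0, forall n, (n0 <= n)%N ->
    forall f, f \in s -> modulus n w (profile f).
  by exists n0.+1 => // f fs; exact: Hn.
elim: s => [|f s [n0 IH]]; first by exists 0%N.
have [n1 H1] := uniform_modulus (@profile_continuous R f) w0.
exists (maxn n0 n1) => n; rewrite geq_max => /andP[nn0 nn1] g.
by rewrite inE => /predU1P[->|gs]; [exact: H1|exact: IH].
Qed.

Lemma branch_continuous n N (V : nat -> I -> R) i :
  (forall j, continuous (V j)) ->
  continuous (fun t : I => branch n N (V ^~ t) i : R).
Proof.
move=> cV.
have cst (r : R) t : {for t, continuous (fun _ : I => r)}.
  exact: cst_continuous.
have cS p : continuous
    (fun t : I => \sum_(j < p) clamp (i.+1%:R - N%:R * V j t) : R).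
  elim: p => [|p IH] t.
    under eq_fun do rewrite big_ord0.
    exact: cst.
  under eq_fun do rewrite big_ord_recr /=.
  apply: (@continuousD R R^o I) => //; first exact: IH.
  have cN := @continuousM R I _ _ t (cst N%:R t) (cV p t).
  have cB := @continuousB R R^o I _ _ t (cst i.+1%:R t) cN.
  exact: (@continuous_comp I R R _ (@clamp R) t cB (@clamp_continuous R _)).
by move=> t; exact: (@continuousM R I _ _ t (cst n%:R^-1 t) (cS n t)).
Qed.

Lemma Re_mean N (psi : 'I_N -> C01 R -> C01 R) f t :
  re ((N%:R^-1 *: \sum_(i < N) psi i f) t) =
  N%:R^-1 * \sum_(i < N) re (psi i f t).
Proof. by rewrite C01Z C01_sum natC -fmorphV ReZ Re_sum. Qed.

Lemma mean_linear N (psi : 'I_N -> C01 R -> C01 R) (z : R[i]) f :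
  (forall i, star_hom (psi i)) ->
  N%:R^-1 *: \sum_(i < N) psi i (z *: f) =
  z *: (N%:R^-1 *: \sum_(i < N) psi i f).
Proof.
move=> hpsi; rewrite [RHS]scalerA mulrC -scalerA; congr (_ *: _).
rewrite scaler_sumr; apply: eq_bigr => i _.
have [lin _ _] := hpsi i.
have p0 : psi i 0 = 0.
  by have := lin (-1) 0 0; rewrite scaleN1r oppr0 addr0 scaleN1r addNr.
by have := lin z f 0; rewrite p0 !addr0.
Qed.

Lemma C01_relZ a k (z : R[i]) f : C01_rel a k f -> C01_rel a k (z *: f).
Proof. by rewrite /C01_rel /mkset !C01Z => ->; rewrite mulrCA. Qed.

Lemma Re_C01_rel a k f : C01_rel a k f ->
  re (f left_end) = a%:R / (a + k)%:R * re (f right_end).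
Proof.
by rewrite /C01_rel /mkset !natC -fmorphV -rmorphM => ->; rewrite ReZ.
Qed.

(** Since the relation has a real coefficient, it can be checked on real
    parts of scalar multiples. *)
Lemma C01_relP a k f :
  (forall z : R[i], re ((z *: f) left_end) =
     a%:R / (a + k)%:R * re ((z *: f) right_end)) -> C01_rel a k f.
Proof.
move=> H; have h1 := H 1; have h2 := H (- 'i%C).
rewrite !C01Z !Re_mulNi in h2; rewrite !C01Z !mul1r in h1.
rewrite /C01_rel /mkset !natC -fmorphV -rmorphM.
move: h1 h2; case: (f left_end) => x y; case: (f right_end) => x' y' /=.
move=> -> ->; apply/eqP.
by rewrite eq_complex /= !mul0r subr0 addr0 !eqxx.
Qed.

End Main.

Unset Implicit Arguments.
Set Strict Implicit.
Set Printing Implicit Defensive.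

Theorem theorem1p2 (R : realType) (a b k : nat)
    (a_gt0 : (0 < a)%N) (b_gt0 : (0 < b)%N) (k_gt0 : (0 < k)%N)
    (ltab : (a < b)%N)
    (F : set (C01 R)) (finF : finite_set F) (subF : F `<=` C01_rel a k)
    (eps : R) (eps_gt0 : 0 < eps)
    (phi : {linear C01 R -> C01 R})
    (phi1 : phi 1 = 1) (phi_pos : positive_map phi)
    (phi_rel : forall f, C01_rel a k f -> C01_rel b k (phi f)) :
  exists (N : nat) (psi : 'I_N -> C01 R -> C01 R),
    [/\ (0 < N)%N,
        forall i, star_hom (psi i),
        forall f, C01_rel a k f ->
          C01_rel b k (N%:R^-1 *: \sum_(i < N) psi i f) &
        forall f, F f ->
          supnorm (phi f - N%:R^-1 *: \sum_(i < N) psi i f) < eps].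
Proof.
(* The final bound is 4 w for each of the real and imaginary parts. *)
pose w := eps / 9; have w0 : 0 < w by rewrite divr_gt0.
(* The functions -i f have the imaginary parts of the f as real parts. *)
have [n n0 Fw] : exists2 n, (0 < n)%N &
    forall f, (F `|` [set - 'i%C *: f | f in F]) f -> modulus n w (profile f).
  by apply: common_modulus => //; rewrite finite_setU; split=> //;
    exact: finite_image.
pose m := (n * (2 * n + 2))%N; pose N := (b * m * (b + k))%N.
have m0 : (0 < m)%N by rewrite muln_gt0 n0 addn_gt0 orbT.
have N0 : (0 < N)%N by rewrite muln_gt0 (muln_gt0 b) b_gt0 m0 addn_gt0 b_gt0.
have [V [cV V01 Vmono Vw Vends]] :=
  adjusted_weights phi1 phi_pos n0 k_gt0 ltab phi_rel (m := m)
    ltac:(rewrite /m; nia).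
have nnm : (n * n <= m)%N.
  by rewrite leq_mul2l mul2n -addnn -addnA leq_addr orbT.
have mN : (m <= N)%N.
  by rewrite /N -mulnA mulnCA leq_pmulr // muln_gt0 b_gt0 addn_gt0 b_gt0.
pose psi (i : 'I_N) :=
  pullback (branch_continuous (n := n) (N := N) (i := i) cV).
have psi_hom i : star_hom (psi i) by exact: star_hom_pullback.
have meanE f t : re ((N%:R^-1 *: \sum_(i < N) psi i f) t) =
    N%:R^-1 * \sum_(i < N) profile f (branch n N (V ^~ t) i).
  by rewrite Re_mean.
exists N, psi; split => //.
- move=> f f_rel; apply: C01_relP => z; rewrite -mean_linear // !meanE.
  have : profile (z *: f) 0 = a%:R / (a + k)%:R * profile (z *: f) 1.
    have := Re_C01_rel (C01_relZ z f_rel).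
    by rewrite left_endE right_endE.
  move: (profile (z *: f)) => u u_rel.
  have exact_mean t : (forall j, (j < n)%N ->
        exists q : nat, N%:R * V j t = q%:R) ->
      N%:R^-1 * \sum_(i < N) u (branch n N (V ^~ t) i) =
      u 1 + \sum_(j < n) V j t * (u (node n j) - u (node n j.+1)).
    by move=> Vnat; apply: mean_branches_exact => // [j|i j]; [exact: V01|
      exact: Vmono].
  rewrite !exact_mean; try by move=> j /Vends[].
  have -> : \sum_(j < n) V j left_end * (u (node n j) - u (node n j.+1)) =
      (a + k)%:R / (b + k)%:R * (u 0 - u 1) + b%:R / (b + k)%:R *
      \sum_(j < n) V j right_end * (u (node n j) - u (node n j.+1)).
    rewrite -opprB -(sum_node_steps u n0) mulr_sumr mulrN -mulrN -sumrN.
    rewrite !mulr_sumr -big_split /=; apply: eq_bigr => j _.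
    by have [-> _ _] := Vends j (ltn_ord j); ring.
  rewrite u_rel !natrD.
  have ak0 : (a%:R + k%:R : R) != 0.
    by rewrite -natrD pnatr_eq0 -lt0n addn_gt0 a_gt0.
  have bk0 : (b%:R + k%:R : R) != 0.
    by rewrite -natrD pnatr_eq0 -lt0n addn_gt0 b_gt0.
  by field; rewrite ak0 bk0.
- move=> f Ff; pose g : C01 R := phi f - N%:R^-1 *: \sum_(i < N) psi i f.
  have close h t : modulus n w (profile h) ->
      `|re ((phi h - N%:R^-1 *: \sum_(i < N) psi i h) t)| <= 4 * w.
    move=> hw; rewrite C01B ReB meanE.
    apply: (approximation_by_branches phi1 phi_pos n0 (m := m) hw) => //.
    + exact: ltW.
    + by move=> j; exact: V01.
    + by move=> i j; exact: Vmono.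
    + by move=> j; exact: Vw.
  apply: (@le_lt_trans _ _ (4 * w + 4 * w)); last by rewrite /w; lra.
  apply: supnorm_le => t; first by apply/close/Fw; left.
  rewrite -Re_mulNi -C01Z scalerBr -mean_linear // -linearZ.
  by apply/close/Fw; right; exists f.
Qed.
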